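(* Let $A, B$ be closed self-adjoint operators in a complex Hilbert space $\mathbb{H}$ with $B$ invertible (with $B^{-1}\in\mathcal{B}(\mathbb{H})$) and $AB=BA$. For every non-negative integer $n$ and every $\epsilon>0$, $$\Lambda_{n,\epsilon}(A,B)\subseteq \sigma(A,B)+ \Delta_{r} \subseteq \mathbb{R}+\Delta_{r},\qquad r=\epsilon \left\|B^{-2^n} \right\|^{\frac{1}{2^n}}.$$
   Context: $\mathcal{B}(\mathbb{H})$ is the set of bounded linear operators on $\mathbb{H}$. For closed (possibly unbounded) operators $A,B$ in $\mathbb{H}$ and $\lambda\in\mathbb{C}$, the pencil $\lambda B-A$ is defined on $D(A)\cap D(B)$. The generalized resolvent set is $\rho(A,B)=\{\lambda\in\mathbb{C}: (\lambda B-A)^{-1}\in\mathcal{B}(\mathbb{H})\}$ and $\sigma(A,B)=\mathbb{C}\setminus\rho(A,B)$. The $(n,\epsilon)$-pseudospectrum is $$\Lambda_{n,\epsilon}(A,B)=\sigma(A,B)\cup\left\{\lambda\in\mathbb{C}: \left\|(\lambda B-A)^{-2^n}\right\|^{1/2^n}\ge \epsilon^{-1}\right\}.$$ For $r>0$, $\Delta_r=\{\lambda\in\mathbb{C}:|\lambda|\le r\}$; sums of subsets of $\mathbb{C}$ are Minkowski sums. *)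

(* Defs.v *)
From mathcomp Require Import all_boot all_order all_algebra.
From mathcomp Require Import complex.
From mathcomp Require Import all_classical all_reals all_analysis.

Set Implicit Arguments.
Unset Strict Implicit.
Unset Printing Implicit Defensive.

Import Order.TTheory GRing.Theory Num.Theory Num.Def.
Import numFieldNormedType.Exports.

Local Open Scope classical_set_scope.
Local Open Scope ring_scope.
Local Open Scope complex_scope.

(* A possibly unbounded linear operator in [H]. The values of [op] outside
   [dom] are meaningless; [graph] below forgets them, and equality of operators
   (same domain, same values on it) is equality of graphs. *)
Record linop (K : numFieldType) (H : lmodType K) := LinOp {
  dom : set H;
  op :> H -> H;
  dom0 : dom 0;
  domP : forall (a : K) (x y : H), dom x -> dom y -> dom (a *: x + y);
  opP : forall (a : K) (x y : H), dom x -> dom y ->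
    op (a *: x + y) = a *: op x + op y
}.

Section Operators.
Variables (K : numFieldType) (H : lmodType K).
Implicit Types (S T : linop H).

Definition graph S : set (H * H) := [set p | dom S p.1 /\ p.2 = S p.1].

Lemma op0 S : S 0 = 0.
Proof.
have := opP (-1) (dom0 S) (dom0 S).
by rewrite scaleN1r oppr0 addr0 scaleN1r addNr.
Qed.

Lemma comp_dom0 S T : (dom T `&` T @^-1` dom S) 0.
Proof. by split; rewrite /= ?op0; exact: dom0. Qed.

Lemma comp_domP S T (a : K) (x y : H) :
  (dom T `&` T @^-1` dom S) x -> (dom T `&` T @^-1` dom S) y ->
  (dom T `&` T @^-1` dom S) (a *: x + y).
Proof.
move=> [Tx STx] [Ty STy]; split; first exact: domP.
by rewrite /= opP //; exact: domP.
Qed.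

Lemma comp_opP S T (a : K) (x y : H) :
  (dom T `&` T @^-1` dom S) x -> (dom T `&` T @^-1` dom S) y ->
  S (T (a *: x + y)) = a *: S (T x) + S (T y).
Proof. by move=> [Tx STx] [Ty STy]; rewrite !opP. Qed.

Definition linop_comp S T : linop H :=
  LinOp (@comp_dom0 S T) (@comp_domP S T) (@comp_opP S T).

Lemma pencil_dom0 S T : (dom S `&` dom T) 0.
Proof. by split; exact: dom0. Qed.

Lemma pencil_domP S T (a : K) (x y : H) :
  (dom S `&` dom T) x -> (dom S `&` dom T) y ->
  (dom S `&` dom T) (a *: x + y).
Proof. by move=> [Sx Tx] [Sy Ty]; split; exact: domP. Qed.

Lemma pencil_opP S T (l a : K) (x y : H) :
  (dom S `&` dom T) x -> (dom S `&` dom T) y ->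
  l *: T (a *: x + y) - S (a *: x + y) =
    a *: (l *: T x - S x) + (l *: T y - S y).
Proof.
move=> [Sx Tx] [Sy Ty]; rewrite !opP // scalerDr scalerBr !scalerA.
by rewrite (mulrC l a) opprD addrACA.
Qed.

(* [pencil A B l] is l B - A: the operands are in the order of the pair (A, B). *)
Definition pencil S T (l : K) : linop H :=
  LinOp (@pencil_dom0 S T) (@pencil_domP S T) (@pencil_opP S T l).

Definition is_inverse S (V : H -> H) : Prop :=
  (forall x, dom S x -> V (S x) = x) /\
  (forall y, dom S (V y) /\ S (V y) = y).

End Operators.

Section HilbertOperators.
Variables (R : realType) (H : completeNormedModType R[i]).
Implicit Types (A B : linop H).

Definition bounded_inverse (S : linop H) (V : {linear H -> H}) : Prop :=
  bounded_near V (nbhs (0 : H)) /\ is_inverse S V.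

Definition closed_op (S : linop H) : Prop := closed (graph S).

(* The pairs (y, z) such that z is a value of the adjoint at y. *)
Definition adjoint_graph (dot : {dot H for conjC}) (S : linop H) :
    set (H * H) :=
  [set p | forall x, dom S x -> dot (S x) p.1 = dot x p.2].

Definition self_adjoint (dot : {dot H for conjC}) (S : linop H) : Prop :=
  dense (dom S) /\ graph S = adjoint_graph dot S.

(* The norm of [H] takes its (real) values in R[i], hence the projection. *)
Definition opnorm (V : H -> H) : R :=
  sup [set complex.Re `|V x| | x in [set x : H | `|x| <= 1]].

Definition root_norm (n : nat) (V : H -> H) : R :=
  opnorm (iter (2 ^ n) V) `^ ((2 ^ n)%:R)^-1.

Definition resolvent_set A B : set R[i] :=
  [set l | exists V : {linear H -> H}, bounded_inverse (pencil A B l) V].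

Definition spectrum A B : set R[i] := ~` resolvent_set A B.

(* Where the pencil has no bounded inverse, l is already in the spectrum, so
   the norm condition is only stated for the bounded inverse [V]. *)
Definition pseudospectrum (n : nat) (eps : R) A B : set R[i] :=
  spectrum A B `|`
  [set l | exists2 V : {linear H -> H},
     bounded_inverse (pencil A B l) V & eps^-1 <= root_norm n V].

End HilbertOperators.

Section PlaneSets.
Variable R : realType.

Definition disk (r : R) : set R[i] := [set z | `|z| <= r%:C].

Definition real_line : set R[i] := range (real_complex R).

Definition minkowski_sum (S T : set R[i]) : set R[i] :=
  [set s + t | s in S & t in T].

End PlaneSets.

Arguments real_line R : clear implicits.

(* Main.v *)
Require Import Defs.
From HB Require Import structures.
From mathcomp Require Import all_boot all_order all_algebra.
From mathcomp Require Import complex.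
From mathcomp Require Import all_classical all_reals all_analysis.
From mathcomp Require Import ring lra.
Import Order.TTheory GRing.Theory Num.Theory Num.Def.
Import numFieldNormedType.Exports.

(** Put W = B^-1 and T = A W, with domain all y such that W y is in the domain
    of A. On the intersection of the two domains l B - A = (l - T) B, so the
    pencil at l is inverted by V exactly when l - T is inverted by K = B V, and
    then V = W K. The theorem is therefore about the single operator T
    ([quotient_op], [pencil_inverse]).

    T is self-adjoint. Since W A is contained in A W, the adjoint of T is
    contained in the adjoint of W A, and that one is T because W is symmetric
    and A is self-adjoint. It remains to see that T is symmetric; for this,
    vectors of the domain of T are approximated in the graph norm of T by
    vectors of the domain of A, namely by their images under i t (i t - A)^-1
    with t large, which commute with W ([resolvent_surj], [yosida],
    [quotient_sym], [quotient_self_adjoint]). Consequently l - T is bijective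
    with a bounded inverse for every nonreal l, and the spectrum of the pencil
    is real ([nonreal_resolvent]): this gives the second inclusion.

    For the first inclusion, every l is shown to have a real spectral point m
    with |l - m| |x| <= |l x - T x| on the domain of T ([nearest_spectrum]).
    Since |(T - a - i b) x|^2 = |(T - a) x|^2 + b^2 |x|^2 for a symmetric T, it
    is enough to treat l = a real and in the resolvent set. There
    S = (T - a)^-1 is symmetric and defined everywhere, hence bounded, by the
    Hellinger-Toeplitz theorem. If M is its norm, then S^2 - M^2 is not bounded
    below, so S - M or S + M is not bounded below, which puts a + 1/M or a - 1/M
    in the spectrum, while |(T - a) x| >= |x| / M.

    Finally W commutes with K, so V^N = W^N K^N for N = 2^n and
    |V^N| <= |W^N| / |l - m|^N. Hence |l - m| |V^N|^(1/N) <= |W^N|^(1/N)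
    ([root_norm_comp]), and if 1/eps <= |V^N|^(1/N) then
    |l - m| <= eps |W^N|^(1/N).

    Inner products are used through their real parts: for operators that are
    linear over the complex numbers, symmetry and self-adjointness for the real
    part are equivalent to those for the complex form, and all estimates become
    inequalities between real numbers. *)

Set Implicit Arguments.
Unset Strict Implicit.
Unset Printing Implicit Defensive.

Local Open Scope classical_set_scope.
Local Open Scope ring_scope.
Local Open Scope complex_scope.

(** * Norms as real numbers *)

Section RealNorm.
Variables (R : realType) (H : completeNormedModType R[i]).
Implicit Types (x y z : H) (a b : R).

(** Norms take their values in R[i], where the order is partial; [modulus] and
    [nrm] bring them back to R, where linear arithmetic applies. *)
Definition modulus (l : R[i]) : R := complex.Re `|l|.

Definition nrm x : R := complex.Re `|x|.

Lemma nrmE x : (nrm x)%:C = `|x|.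
Proof. by rewrite /nrm RRe_real // ger0_real. Qed.

Lemma modulusE (l : R[i]) : (modulus l)%:C = `|l|.
Proof. by rewrite /modulus RRe_real // ger0_real. Qed.

Lemma nrm_ge0 x : 0 <= nrm x.
Proof. by rewrite -lecR nrmE; exact: normr_ge0. Qed.

Lemma modulus_ge0 (l : R[i]) : 0 <= modulus l.
Proof. by rewrite -lecR modulusE; exact: normr_ge0. Qed.

Lemma sqr_modulus a b : modulus (a +i* b) ^+ 2 = a ^+ 2 + b ^+ 2.
Proof. by rewrite /modulus normc_def /= sqr_sqrtr // addr_ge0 ?sqr_ge0. Qed.

Lemma modulus_real a : modulus a%:C = `|a|.
Proof.
by apply: complexI; rewrite modulusE /= normc_def /= expr0n addr0 sqrtr_sqr.
Qed.

Lemma nrmZ (l : R[i]) x : nrm (l *: x) = modulus l * nrm x.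
Proof. by apply: complexI; rewrite rmorphM /= modulusE !nrmE normrZ. Qed.

Lemma nrmN x : nrm (- x) = nrm x.
Proof. by rewrite /nrm normrN. Qed.

Lemma nrmB x y : nrm (x - y) = nrm (y - x).
Proof. by rewrite /nrm distrC. Qed.

Lemma nrmD x y : nrm (x + y) <= nrm x + nrm y.
Proof. by rewrite -lecR rmorphD /= !nrmE ler_normD. Qed.

Lemma nrm0 : nrm (0 : H) = 0.
Proof. by rewrite /nrm normr0. Qed.

Lemma nrm_eq0 x : nrm x = 0 -> x = 0.
Proof. by move=> x0; apply/eqP; rewrite -normr_eq0 -nrmE x0. Qed.

(** Completeness with an explicit rate: the limit inherits the bounds assumed
    between terms, so that no filter is needed when it is used. *)
Lemma complete_rate (u : nat -> H) (b : nat -> R) :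
  (forall e, 0 < e -> exists n, b n < e) ->
  (forall n k, nrm (u (n + k)%N - u n) <= b n) ->
  exists l, forall n, nrm (l - u n) <= b n.
Proof.
move=> b0 ub.
have /cvg_ex[l ul] : cvg (u @ \oo).
  apply: cauchy_cvg; apply: cauchy_exP => e e0.
  have e_re : e = (complex.Re e)%:C by rewrite RRe_real // gtr0_real.
  have [n bn] := b0 (complex.Re e) ltac:(by rewrite -ltcR -e_re).
  exists (u n), n => // m /= nm.
  rewrite -ball_normE /ball_ /= -nrmE nrmB e_re ltcR.
  by apply: le_lt_trans bn; rewrite -(subnKC nm).
exists l => n; apply/ler_addgt0Pr => e e0.
move/cvgrPdist_lt : ul => /(_ e%:C); rewrite ltcR => /(_ e0)[N _ uN].
have := uN (n + N)%N (leq_addl _ _); rewrite /= -nrmE ltcR => lu.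
rewrite -(subrKA (u (n + N)%N)) (le_trans (nrmD _ _)) //.
by rewrite addrC lerD // ltW.
Qed.

Lemma dense_approx (D : set H) : dense D ->
  forall x e, 0 < e -> exists2 y, D y & nrm (x - y) < e.
Proof.
move=> dD x e e0.
have e0' : 0 < e%:C by rewrite ltcR.
have [||y [xy Dy]] := dD (ball x e%:C).
- by exists x; apply: ballxx.
- exact: ball_open.
exists y => //; move: xy; rewrite -ball_normE /ball_ /= -nrmE.
by rewrite ltcR.
Qed.

Lemma bounded_nrm (V : {linear H -> H}) : bounded_near V (nbhs (0 : H)) ->
  exists2 c, 0 <= c & forall x, nrm (V x) <= c * nrm x.
Proof.
move=> /linear_boundedP/pinfty_ex_gt0[c c0 Vc].
have cE : c = (complex.Re c)%:C by rewrite RRe_real // gtr0_real.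
exists (complex.Re c); first by rewrite -lecR -cE ltW.
by move=> x; rewrite -lecR rmorphM /= !nrmE -cE Vc.
Qed.

Lemma nrm_bounded (V : {linear H -> H}) c :
  (forall x, nrm (V x) <= c * nrm x) -> bounded_near V (nbhs (0 : H)).
Proof.
move=> Vc; apply/linear_boundedP; near=> r => x.
apply: (@le_trans _ _ (c%:C * `|x|)); first by rewrite -!nrmE -rmorphM lecR.
apply: ler_wpM2r => //.
by near: r; apply: nbhs_pinfty_ge; rewrite complex_real.
Unshelve. all: by end_near. Qed.

End RealNorm.

(** * The real part of the inner product *)

Section RealInner.
Variables (R : realType) (H : completeNormedModType R[i]).
Variables (dot : {dot H for conjC}).
Implicit Types (x y z : H) (a b : R) (S : linop H).

Definition rdot x y : R := complex.Re (dot x y).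

Lemma ReD (u v : R[i]) : complex.Re (u + v) = complex.Re u + complex.Re v.
Proof. by case: u v => ? ? [? ?]. Qed.

Lemma ReN (u : R[i]) : complex.Re (- u) = - complex.Re u.
Proof. by case: u. Qed.

Lemma rdotDl x y z : rdot (x + y) z = rdot x z + rdot y z.
Proof. by rewrite /rdot linearDl ReD. Qed.

Lemma rdotDr x y z : rdot z (x + y) = rdot z x + rdot z y.
Proof. by rewrite /rdot linearDr ReD. Qed.

Lemma rdotNl x y : rdot (- x) y = - rdot x y.
Proof. by rewrite /rdot linearNl ReN. Qed.

Lemma rdotNr x y : rdot y (- x) = - rdot y x.
Proof. by rewrite /rdot linearNr ReN. Qed.

Lemma rdotZl a x y : rdot (a%:C *: x) y = a * rdot x y.
Proof.
rewrite /rdot linearZl_LR /=; case: (dot x y : R[i]) => ? ? /=.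
by rewrite mul0r subr0.
Qed.

Lemma dotC x y : dot x y = (dot y x)^*%C.
Proof. by rewrite [LHS]hermC expr0 mul1r. Qed.

Lemma rdotC x y : rdot x y = rdot y x.
Proof. by rewrite /rdot dotC; case: (dot y x). Qed.

Lemma rdotZr a x y : rdot y (a%:C *: x) = a * rdot y x.
Proof. by rewrite rdotC rdotZl rdotC. Qed.

Lemma rdotil x y : rdot ('i *: x) y = - complex.Im (dot x y).
Proof.
rewrite /rdot linearZl_LR /=; case: (dot x y) => ? ? /=.
by rewrite mul0r mul1r sub0r.
Qed.

(** Multiplication by i is skew for the real part; hence Re <x, i x> = 0, and
    Re <S x, i x> = 0 when S is symmetric. *)
Lemma rdotiN x y : rdot ('i *: x) y = - rdot x ('i *: y).
Proof.
by rewrite [in RHS]rdotC !rdotil opprK [dot y x]dotC; case: (dot x y).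
Qed.

Lemma rdotii x y : rdot ('i *: x) ('i *: y) = rdot x y.
Proof.
by rewrite rdotiN scalerA -expr2 sqr_i scaleN1r rdotNr opprK.
Qed.

Definition rdotE := (rdotDl, rdotDr, rdotNl, rdotNr, rdotZl, rdotZr, rdotii).

Hypothesis dot_norm : forall x : H, dot x x = `|x| ^+ 2.

Lemma rdotxx x : rdot x x = nrm x ^+ 2.
Proof.
apply: complexI; rewrite rmorphXn /= nrmE -dot_norm RRe_real // dot_norm.
by rewrite rpredX // normr_real.
Qed.

Lemma scale_complex a b x : (a +i* b) *: x = a%:C *: x + b%:C *: ('i *: x).
Proof.
by rewrite scalerA -scalerDl; congr (_ *: _); rewrite [LHS]complexE /= [_ * 'i]mulrC.
Qed.

Lemma cauchy_schwarz x y : rdot x y <= nrm x * nrm y.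
Proof.
have [y0|y0] := eqVneq (nrm y) 0.
  by rewrite y0 (nrm_eq0 y0) -(scale0r (0 : H)) (_ : 0 = 0%:C) // rdotZr mul0r mulr0.
have ypos : 0 < nrm y by rewrite lt_def y0 nrm_ge0.
have [x0|x0] := eqVneq (nrm x) 0.
  by rewrite x0 (nrm_eq0 x0) -(scale0r (0 : H)) (_ : 0 = 0%:C) // rdotZl !mul0r.
have xpos : 0 < nrm x by rewrite lt_def x0 nrm_ge0.
have := sqr_ge0 (nrm ((nrm y)%:C *: x - (nrm x)%:C *: y)).
rewrite -rdotxx !rdotE !rdotxx (rdotC y x) => h.
have : 0 <= (nrm x * nrm y) * (nrm x * nrm y - rdot x y) by lra.
by rewrite pmulr_rge0 ?mulr_gt0 // subr_ge0.
Qed.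

(** S coincides with its adjoint, for the real part of the inner product. *)
Definition real_self_adjoint S := forall y z,
  (dom S y /\ z = S y) <-> (forall x, dom S x -> rdot (S x) y = rdot x z).

Lemma domZ S (l : R[i]) x : dom S x -> dom S (l *: x).
Proof. by move=> Sx; rewrite -[_ *: _]addr0; apply: domP => //; exact: dom0. Qed.

Lemma opZ S (l : R[i]) x : dom S x -> S (l *: x) = l *: S x.
Proof. by move=> Sx; rewrite -[l *: x]addr0 opP ?op0 ?addr0 //; exact: dom0. Qed.

Lemma domD S x y : dom S x -> dom S y -> dom S (x + y).
Proof. by move=> Sx Sy; rewrite -[x]scale1r; exact: domP. Qed.

Lemma opD S x y : dom S x -> dom S y -> S (x + y) = S x + S y.
Proof. by move=> Sx Sy; rewrite -{1}[x]scale1r opP // scale1r. Qed.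

Lemma domB S x y : dom S x -> dom S y -> dom S (x - y).
Proof. by move=> Sx Sy; rewrite -scaleN1r; apply: domD => //; exact: domZ. Qed.

Lemma opB S x y : dom S x -> dom S y -> S (x - y) = S x - S y.
Proof.
by move=> Sx Sy; have := domZ (-1) Sy => Ny; rewrite -(scaleN1r y) opD // opZ // scaleN1r.
Qed.

(** The imaginary part of the defining identity at x is its real part at i x. *)
Lemma self_adjoint_real S : self_adjoint dot S -> real_self_adjoint S.
Proof.
move=> [_ /seteqP[gsub gsup]] y z; split=> [Sy x Sx|yz].
  by rewrite /rdot (gsub (y, z) Sy).
apply: (gsup (y, z)) => x Sx /=.
have re := yz x Sx.
have := yz _ (domZ 'i Sx); rewrite opZ // !rdotil => /oppr_inj im.
by move: re im; rewrite /rdot; case: (dot _ _) (dot _ _) => ? ? [? ?] /= -> ->.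
Qed.

Definition symmetric_op S :=
  forall x y, dom S x -> dom S y -> rdot (S x) y = rdot x (S y).

Lemma real_self_adjoint_sym S : real_self_adjoint S -> symmetric_op S.
Proof. by move=> Ssa x y Sx Sy; apply: (Ssa y (S y)).1. Qed.

(** The cross term b Re (<S x - a x, i x>) vanishes because <S x, x> is real. *)
Lemma sqr_nrm_shift S a b x : symmetric_op S -> dom S x ->
  nrm (S x - (a +i* b) *: x) ^+ 2 =
  nrm (S x - a%:C *: x) ^+ 2 + (b * nrm x) ^+ 2.
Proof.
move=> Ssym Sx; rewrite exprMn -!rdotxx scale_complex !rdotE.
have im : rdot (S x) ('i *: x) = 0.
  have := Ssym x ('i *: x) Sx (domZ 'i Sx).
  by rewrite opZ // -[rdot x ('i *: S x)]opprK -rdotiN (rdotC ('i *: x)); lra.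
have im' : rdot x ('i *: x) = 0.
  have := rdotiN x x; rewrite rdotC; lra.
rewrite (rdotC ('i *: x) x) (rdotC ('i *: x) (S x)) (rdotC x (S x)) im im'; ring.
Qed.

End RealInner.

(** * Projections and resolvents of self-adjoint operators *)

Section Geometric.
Variable R : realType.

Lemma geometric_small (k : nat) (c e : R) : (1 < k)%N -> 0 < e ->
  exists n, c / k%:R ^+ n < e.
Proof.
move=> k1 e0; (* n < k ^ n, and c / e is below the first natural number after it. *)
exists (truncn (c / e)).+1.
have k0 : (0 : R) < k%:R by rewrite ltr0n (ltn_trans _ k1).
rewrite ltr_pdivrMr ?exprn_gt0 // mulrC -ltr_pdivrMr // (lt_trans (truncnS_gt _)) //.
by rewrite -natrX ltr_nat ltn_expl.
Qed.

Lemma eq0_geometric (c r : R) : (forall n, `|r| <= c / 2 ^+ n) -> r = 0.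
Proof.
move=> rc; apply/eqP; rewrite -normr_le0 leNgt; apply/negP => r0.
have [n] := @geometric_small 2 c `|r| isT r0.
by rewrite ltNge rc.
Qed.

End Geometric.

Section Hilbert.
Variables (R : realType) (H : completeNormedModType R[i]).
Variables (dot : {dot H for conjC}).
Hypothesis dot_norm : forall x : H, dot x x = `|x| ^+ 2.
Implicit Types (x y z : H) (a b c : R) (S : linop H).
Local Notation rdot := (rdot dot).

Lemma cauchy_schwarz_abs x y : `|rdot x y| <= nrm x * nrm y.
Proof.
rewrite ler_norml cauchy_schwarz // andbT lerNl -rdotNl -(nrmN x).
exact: cauchy_schwarz.
Qed.

(** A minimizing sequence u of the distance from y to V is Cauchy by the
    parallelogram law, at the rate 2 / 2^n when u n is optimal up to 4^-n.
    Comparing y - u n with y - u n - 2^-n w then bounds <w, y - u n>, up to a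
    constant, by 2^-n, and the limit is orthogonal to V. *)
Lemma orthogonal_projection (V : set H) :
  V 0 -> (forall x y, V x -> V y -> V (x + y)) ->
  (forall a x, V x -> V (a%:C *: x)) ->
  (forall (u : nat -> H) l c, (forall n, V (u n)) ->
     (forall n, nrm (l - u n) <= c / 2 ^+ n) -> V l) ->
  forall y, exists2 v, V v & forall w, V w -> rdot w (y - v) = 0.
Proof.
move=> V0 VD VZ Vclosed y.
pose E := [set nrm (y - v) ^+ 2 | v in V].
have Einf : has_inf E.
  split; first by exists (nrm (y - 0) ^+ 2), 0.
  by exists 0 => _ [v _ <-]; rewrite sqr_ge0.
have Ege v : V v -> inf E <= nrm (y - v) ^+ 2.
  by move=> Vv; apply: ge_inf; [exact: Einf.2 | exists v].
have Eadh n : exists v, V v /\ nrm (y - v) ^+ 2 < inf E + (2 ^+ n)^-1 ^+ 2.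
  have [|_ [v Vv <-] vlt] := @inf_adherent _ _ ((2 ^+ n)^-1 ^+ 2) _ Einf.
    by rewrite exprn_gt0 // invr_gt0 exprn_gt0.
  by exists v.
have [u uP] := choice Eadh.
have Vu n : V (u n) by case: (uP n).
have ult n : nrm (y - u n) ^+ 2 < inf E + (2 ^+ n)^-1 ^+ 2 by case: (uP n).
have [v vu] : exists v, forall n, nrm (v - u n) <= 2 / 2 ^+ n.
  apply: complete_rate => [e e0|n k].
    exact: (@geometric_small _ 2).
  rewrite -(@ler_pXn2r _ 2) ?nnegrE ?nrm_ge0 ?divr_ge0 ?exprn_ge0 //.
  have := ult n; have := ult (n + k)%N.
  have := Ege _ (VZ (2^-1) _ (VD _ _ (Vu n) (Vu (n + k)%N))).
  have : (2 ^+ (n + k))^-1 ^+ 2 <= (2 ^+ n)^-1 ^+ 2 :> R.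
    rewrite ler_pXn2r ?nnegrE ?invr_ge0 ?exprn_ge0 //.
    by rewrite lef_pV2 ?posrE ?exprn_gt0 // ler_eXn2l ?leq_addr // ltr1n.
  rewrite exprMn.
  move: ((2 ^+ n)^-1 ^+ 2) ((2 ^+ (n + k))^-1 ^+ 2) => p q.
  rewrite -!(rdotxx dot_norm) !rdotE.
  rewrite (rdotC dot (u n) y) (rdotC dot (u (n + k)%N) y).
  rewrite (rdotC dot (u (n + k)%N) (u n)).
  lra.
exists v => [|w Vw]; first exact: Vclosed vu.
pose c (w : H) := (1 + nrm w ^+ 2) / 2 + 2 * nrm w.
have half (n : nat) w' : V w' -> rdot w' (y - v) <= c w' / 2 ^+ n.
  move=> Vw'; set t := (2 ^+ n : R)^-1.
  have t0 : 0 < t by rewrite invr_gt0 exprn_gt0.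
  have [z zE] : exists z, z = y - u n by exists (y - u n).
  have := ult n; rewrite -/t -zE => zlt.
  have := Ege _ (VD _ _ (Vu n) (VZ t _ Vw')).
  rewrite opprD addrA -zE -(rdotxx dot_norm (z - _)).
  rewrite (rdotDl dot z) !(rdotDr dot z) !rdotNl !rdotNr !rdotZl !rdotZr.
  rewrite !(rdotxx dot_norm) (rdotC dot z w') => le.
  (* Minimality along w' gives 2 t <w', z> <= t^2 + t^2 |w'|^2. *)
  have h1 : rdot w' z <= t * ((1 + nrm w' ^+ 2) / 2).
    rewrite -(ler_pM2l t0); nra.
  have h2 : rdot w' (u n - v) <= nrm w' * (2 * t).
    apply: le_trans (cauchy_schwarz dot_norm _ _) _.
    by rewrite ler_wpM2l ?nrm_ge0 // nrmB vu.
  have -> : y - v = z + (u n - v) by rewrite zE addrA subrK.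
  rewrite rdotDr /c; nra.
apply: (@eq0_geometric _ (c w)) => n; rewrite ler_norml half // andbT lerNl.
rewrite -rdotNl; have -> : c w = c (- w) by rewrite /c nrmN.
apply: half.
have -> : - w = (-1)%:C *: w by rewrite rmorphN scaleN1r.
exact: VZ.
Qed.

(** In particular S - l is injective, with a bounded inverse on its range, for
    every nonreal l. *)
Lemma nrm_shift_ge_im S a b x : symmetric_op dot S -> dom S x ->
  `|b| * nrm x <= nrm (S x - (a +i* b) *: x).
Proof.
move=> Ssym Sx; rewrite -(@ler_pXn2r _ 2) ?nnegrE ?mulr_ge0 ?nrm_ge0 //.
rewrite (sqr_nrm_shift dot_norm) // exprMn real_normK ?num_real // exprMn.
by rewrite lerDr sqr_ge0.
Qed.

(** The range of S - l is closed, because S is closed and S - l is bounded below.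
    A vector w orthogonal to it satisfies S w = l^* w, by self-adjointness, and
    l^* is not real, so w = 0. *)
Lemma resolvent_surj S a b : real_self_adjoint dot S -> b != 0 ->
  forall y, exists2 x, dom S x & S x - (a +i* b) *: x = y.
Proof.
move=> Ssa b0 y; have Ssym := real_self_adjoint_sym Ssa.
pose L x := S x - (a +i* b) *: x.
have b_gt0 : 0 < `|b| by rewrite normr_gt0.
have LD x x' : dom S x -> dom S x' -> L (x + x') = L x + L x'.
  by move=> Sx Sx'; rewrite /L opD // scalerDr opprD addrACA.
have LZ l x : dom S x -> L (l *: x) = l *: L x.
  by move=> Sx; rewrite /L opZ // scalerBr !scalerA mulrC.
have LB x x' : dom S x -> dom S x' -> L (x - x') = L x - L x'.
  move=> Sx Sx'; have SNx' := domZ (-1) Sx'.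
  by rewrite -(scaleN1r x') LD // LZ // scaleN1r.
have [||||v [x Sx <-] vorth] := @orthogonal_projection [set L x | x in dom S] _ _ _ _ y.
- by exists 0; [exact: dom0 | rewrite /L op0 scaler0 subr0].
- move=> _ _ [x Sx <-] [x' Sx' <-].
  by exists (x + x'); [exact: domD | exact: LD].
- by move=> c _ [x Sx <-]; exists (c%:C *: x); [exact: domZ | exact: LZ].
- move=> u l c Vu ul.
  have /choice[x xP] : forall n, exists x, dom S x /\ L x = u n.
    by move=> n; have [x Sx Lx] := Vu n; exists x.
  have Sx n : dom S (x n) by case: (xP n).
  have Lx n : L (x n) = u n by case: (xP n).
  have c0 : 0 <= c.
    by rewrite -[c]divr1 -[1](expr0 2) (le_trans _ (ul 0%N)) ?nrm_ge0.
  have [e eE] : exists e, e = 2 * c / `|b| by exists (2 * c / `|b|).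
  have [m mx] : exists m, forall n, nrm (m - x n) <= e / 2 ^+ n.
    apply: complete_rate => [d d0|n k]; first exact: (@geometric_small _ 2).
    rewrite -(ler_pM2l b_gt0).
    have := nrm_shift_ge_im a b Ssym (domB (Sx (n + k)%N) (Sx n)).
    move=> /le_trans; apply; rewrite -/(L _) LB // !Lx -(subrKA l).
    apply: le_trans (nrmD _ _) _; rewrite nrmB.
    have := ul n; have := ul (n + k)%N.
    have : c / 2 ^+ (n + k) <= c / 2 ^+ n.
      rewrite ler_wpM2l // lef_pV2 ?posrE ?exprn_gt0 //.
      by rewrite ler_eXn2l ?leq_addr // ltr1n.
    have -> : `|b| * (e / 2 ^+ n) = 2 * (c / 2 ^+ n).
      by rewrite eE; field; rewrite expf_neq0 //= gt_eqF.
    lra.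
  (* S (x n) = u n + (a + i b) x n converges, and S, being an adjoint, is closed. *)
  suff [Sm Sml] : dom S m /\ l + (a +i* b) *: m = S m.
    by exists m => //; rewrite /L -Sml addrK.
  apply/Ssa => x' Sx'; apply/eqP; rewrite -subr_eq0; apply/eqP.
  set K := modulus (a +i* b).
  apply: (@eq0_geometric _ (nrm (S x') * e + nrm x' * (c + K * e))) => n.
  have -> : rdot (S x') m - rdot x' (l + (a +i* b) *: m) =
      rdot (S x') (m - x n) - rdot x' (l - u n + (a +i* b) *: (m - x n)).
    rewrite -Lx /L scalerBr !(rdotE dot) (Ssym _ _ Sx' (Sx n)).
    lra.
  apply: le_trans (ler_normB _ _) _.
  apply: le_trans (lerD (cauchy_schwarz_abs _ _) (cauchy_schwarz_abs _ _)) _.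
  rewrite mulrDl -!mulrA lerD //; first by rewrite ler_wpM2l ?nrm_ge0 ?mx.
  rewrite ler_wpM2l ?nrm_ge0 // (le_trans (nrmD _ _)) // mulrDl lerD ?ul //.
  by rewrite nrmZ -mulrA ler_wpM2l ?modulus_ge0 ?mx.
exists x => //; apply/eqP; rewrite eq_sym -subr_eq0; apply/eqP.
move: vorth; rewrite -/(L x); move: (y - L x) => w worth.
(* w is orthogonal to the range, so that (w, l^* w) is in the adjoint graph. *)
have [|Sw Swl] := (Ssa w ((a +i* - b) *: w)).2.
  move=> x' Sx'; have := worth _ (ex_intro2 _ _ x' Sx' erefl).
  rewrite /L (scale_complex a b) (scale_complex a (- b)) !rdotE rdotiN.
  lra.
apply: nrm_eq0; apply/eqP; have := nrm_shift_ge_im a (- b) Ssym Sw.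
rewrite -Swl subrr nrm0 normrN pmulr_rle0 // => w0.
by rewrite eq_le w0 nrm_ge0.
Qed.

End Hilbert.

(** * Approximation by resolvents, and automatic boundedness *)

Section Operators.
Variables (R : realType) (H : completeNormedModType R[i]).
Variables (dot : {dot H for conjC}).
Hypothesis dot_norm : forall x : H, dot x x = `|x| ^+ 2.
Implicit Types (x y z : H) (a b c t : R) (S : linop H).
Local Notation rdot := (rdot dot).

(** The hypothesis on x says that x = i t (i t - S)^-1 y. These operators are
    contractions, and on a vector y' of the domain they differ from the identity
    by at most |S y'| / t; density of the domain does the rest. The bound is
    uniform in large t so that it can be used for two vectors at once. *)
Lemma yosida S y e : symmetric_op dot S -> dense (dom S) -> 0 < e ->
  exists2 t0, 0 < t0 & forall t x, t0 <= t -> dom S x ->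
    S x - (0 +i* t) *: x = - ((0 +i* t) *: y) -> nrm (x - y) <= e.
Proof.
move=> Ssym Sdense e0.
have [|y' Sy' yy'] := dense_approx Sdense y (e := e / 4); first by rewrite divr_gt0.
exists (1 + 2 * nrm (S y') / e) => [|t x t0t Sx xy].
  by rewrite ltr_pwDl // divr_ge0 ?mulr_ge0 ?nrm_ge0 // ltW.
have t1 : 1 <= t.
  apply: le_trans t0t; rewrite lerDl divr_ge0 ?mulr_ge0 ?nrm_ge0 //; exact: ltW.
have t_gt0 : 0 < t by apply: lt_le_trans t1.
have tS : nrm (S y') <= t * (e / 2).
  rewrite mulrA ler_pdivlMr // mulrC -ler_pdivrMr // (le_trans _ t0t) //.
  by rewrite lerDr.
have xy' : t * nrm (x - y') <= t * nrm (y - y') + nrm (S y').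
  have := nrm_shift_ge_im dot_norm 0 t Ssym (domB Sx Sy').
  have -> : S (x - y') - (0 +i* t) *: (x - y') =
      - ((0 +i* t) *: (y - y') + S y').
    have SxE : S x = (0 +i* t) *: x - (0 +i* t) *: y.
      by rewrite -xy [RHS]addrC subrK.
    by rewrite opB // !scalerBr SxE opprB addrC !addrA subrK opprD opprB.
  rewrite nrmN gtr0_norm // => /le_trans; apply.
  apply: le_trans (nrmD _ _) _; rewrite nrmZ.
  suff -> : modulus (0 +i* t) = t by [].
  apply/eqP; rewrite -(@eqrXn2 _ 2) ?modulus_ge0 ?(ltW t_gt0) //.
  by rewrite sqr_modulus expr0n add0r.
have xy2 : nrm (x - y') <= nrm (y - y') + e / 2.
  by rewrite -(ler_pM2l t_gt0) mulrDr; lra.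
rewrite -(subrKA y') (le_trans (nrmD _ _)) // (nrmB y').
lra.
Qed.

Lemma rdot_inj x y : (forall z, rdot x z = rdot y z) -> x = y.
Proof.
move=> xy; apply/eqP; rewrite -subr_eq0; apply/eqP/nrm_eq0/eqP.
by rewrite -sqrf_eq0 -(rdotxx dot_norm) rdotDl rdotNl xy subrr.
Qed.

(** Were f unbounded, there would be x n in the unit ball whose images v n = f (x n)
    grow faster than 4^n. The partial sums s add a vector of length 4^-(n+1)
    along v n, with the sign for which |<s (n+1), v n>| is at least
    4^-(n+1) |v n|; the later terms have total length at most a third of
    4^-(n+1) and cannot destroy this. For the limit l,
    |f l| >= |<f l, x n>| = |<l, v n>| is then larger than n, for every n. *)
Lemma hellinger_toeplitz (f : H -> H) :
  (forall x y, rdot (f x) y = rdot x (f y)) ->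
  exists2 c, 0 < c & forall x, nrm (f x) <= c * nrm x.
Proof.
move=> fsym.
(* A symmetric map defined everywhere is automatically linear. *)
have fZ a x : f (a%:C *: x) = a%:C *: f x.
  by apply: rdot_inj => z; rewrite fsym !rdotZl fsym.
suff [c fc] : exists c, forall x, nrm x <= 1 -> nrm (f x) <= c.
  exists (`|c| + 1) => [|x]; first by rewrite ltr_wpDl.
  have [x0|x0] := eqVneq (nrm x) 0.
    have -> : f x = 0.
      rewrite (nrm_eq0 x0) -{1}(scale0r (0 : H)) (_ : 0 = 0%:C) // fZ.
      by rewrite scale0r.
    by rewrite nrm0 x0 mulr0.
  have x_gt0 : 0 < nrm x by rewrite lt_def x0 nrm_ge0.
  have := fc ((nrm x)^-1%:C *: x).
  rewrite fZ !nrmZ modulus_real gtr0_norm ?invr_gt0 // mulVf // lexx => /(_ isT).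
  rewrite mulrC ler_pdivrMr // => /le_trans; apply.
  by rewrite ler_wpM2r ?nrm_ge0 // (le_trans (ler_norm c)) // lerDl.
apply: contrapT => unbounded.
have /choice[x xP] : forall n : nat, exists x, nrm x <= 1 /\
    2 * n%:R * 4 ^+ n.+1 < nrm (f x).
  move=> n; apply: contrapT => nx; apply: unbounded.
  exists (2 * n%:R * 4 ^+ n.+1) => x x1; rewrite leNgt; apply/negP => fx.
  by apply: nx; exists x.
pose v n := f (x n).
have v_gt0 n : 0 < nrm (v n).
  apply: le_lt_trans (xP n).2.
  by rewrite !mulr_ge0 ?exprn_ge0.
pose q n : R := (4 ^+ n.+1)^-1 / nrm (v n).
have q_gt0 n : 0 < q n by rewrite divr_gt0 // invr_gt0 exprn_gt0.
pose step n (s : H) := s + (if 0 <= rdot s (v n) then q n else - q n)%:C *: v n.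
pose fix s n := if n is m.+1 then step m (s m) else 0.
have s_step n : nrm (s n.+1 - s n) = (4 ^+ n.+1)^-1.
  rewrite /= /step addrAC subrr add0r nrmZ modulus_real.
  rewrite (_ : `|_| = q n); last by case: ifP; rewrite ?normrN gtr0_norm.
  by rewrite divfK // gt_eqF.
have s_big n : (4 ^+ n.+1)^-1 * nrm (v n) <= `|rdot (s n.+1) (v n)|.
  rewrite /= /step rdotDl rdotZl (rdotxx dot_norm).
  have <- : q n * nrm (v n) ^+ 2 = (4 ^+ n.+1)^-1 * nrm (v n).
    by rewrite expr2 mulrA divfK // gt_eqF.
  have : 0 < q n * nrm (v n) ^+ 2 by rewrite mulr_gt0 // exprn_gt0.
  case: ifP => [r0 qv|/negbT]; first by rewrite ger0_norm; lra.
  rewrite -ltNge => r0 qv; rewrite mulNr ltr0_norm; lra.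
have s_tail n k : nrm (s (n + k)%N - s n) <= ((4 ^+ n)^-1 - (4 ^+ (n + k))^-1) / 3.
  elim: k => [|k IH]; first by rewrite addn0 !subrr mul0r nrm0.
  rewrite addnS -(subrKA (s (n + k)%N)) (le_trans (nrmD _ _)) // s_step.
  move: IH; rewrite exprS invfM; lra.
have [l sl] : exists l, forall n, nrm (l - s n) <= 3^-1 / 4 ^+ n.
  apply: complete_rate => [e e0|n k]; first exact: (@geometric_small _ 4).
  apply: le_trans (s_tail n k) _; rewrite mulrC ler_wpM2l // lerBlDr lerDl.
  by rewrite invr_ge0 exprn_ge0.
have fl n : n%:R < nrm (f l).
  have [x1 fx] := xP n.
  have h1 : `|rdot l (v n)| <= nrm (f l).
    rewrite -fsym (le_trans (cauchy_schwarz_abs dot_norm _ _)) //.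
    by rewrite ler_piMr ?nrm_ge0.
  have h2 : `|rdot (s n.+1) (v n)| <= `|rdot l (v n)| + 3^-1 / 4 ^+ n.+1 * nrm (v n).
    have -> : rdot (s n.+1) (v n) = rdot l (v n) - rdot (l - s n.+1) (v n).
      by rewrite (rdotDl dot l) rdotNl; lra.
    rewrite (le_trans (ler_normB _ _)) // lerD2l.
    rewrite (le_trans (cauchy_schwarz_abs dot_norm _ _)) //.
    by rewrite ler_wpM2r ?nrm_ge0.
  have h3 := s_big n.
  have : 2 * n%:R < (4 ^+ n.+1)^-1 * nrm (v n).
    by rewrite [ltRHS]mulrC ltr_pdivlMr // exprn_gt0.
  have n0 : (0 : R) <= n%:R by rewrite ler0n.
  move: h2; rewrite -mulrA; lra.
have := fl (truncn (nrm (f l))).+1.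
by rewrite ltNge ltW // truncnS_gt.
Qed.

End Operators.

(** * The operator norm *)

Section OperatorNorm.
Variables (R : realType) (H : completeNormedModType R[i]).
Implicit Types (x y z : H) (a b c t : R) (f : H -> H).

Lemma ball1E x : (`|x| <= 1) = (nrm x <= 1).
Proof. by rewrite -nrmE -[1 in LHS]/(1%:C) lecR. Qed.

Lemma opnorm_le f c : (forall x, nrm x <= 1 -> nrm (f x) <= c) -> opnorm f <= c.
Proof.
move=> fc; apply: ge_sup.
  by exists (nrm (f 0)), 0 => //=; rewrite normr0.
by move=> _ [x /= x1 <-]; apply: fc; rewrite -ball1E.
Qed.

Lemma opnorm_ub f c x : (forall x, nrm (f x) <= c * nrm x) -> nrm x <= 1 ->
  nrm (f x) <= opnorm f.
Proof.
move=> fc x1; apply: ub_le_sup; last by exists x => //=; rewrite ball1E.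
exists `|c| => _ [y /= y1 <-]; rewrite ball1E in y1.
apply: le_trans (fc y) _; rewrite -[leRHS]mulr1.
apply: le_trans (ler_wpM2r (nrm_ge0 y) (ler_norm c)) _.
by rewrite ler_wpM2l.
Qed.

(** For an unbounded f the supremum is 0 by convention. *)
Lemma opnorm_ge0 f : 0 <= opnorm f.
Proof.
have [fb|fb] := pselect
  (has_ubound [set complex.Re `|f x| | x in [set x : H | `|x| <= 1]]).
  apply: le_trans (nrm_ge0 (f 0)) _; apply: ub_le_sup => //.
  by exists 0 => //=; rewrite normr0.
by rewrite /opnorm sup_out // => -[].
Qed.

Lemma le_opnorm f c x :
  (forall a x, f (a%:C *: x) = a%:C *: f x) ->
  (forall x, nrm (f x) <= c * nrm x) -> nrm (f x) <= opnorm f * nrm x.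
Proof.
move=> fZ fc.
have [x0|x0] := eqVneq (nrm x) 0.
  by apply: le_trans (fc x) _; rewrite x0 !mulr0.
have x_gt0 : 0 < nrm x by rewrite lt_def x0 nrm_ge0.
have := @opnorm_ub f c ((nrm x)^-1%:C *: x) fc.
rewrite fZ !nrmZ modulus_real gtr0_norm ?invr_gt0 // mulVf // lexx => /(_ isT).
by rewrite mulrC ler_pdivrMr.
Qed.

Lemma iter_bounded f c n x : 0 <= c -> (forall x, nrm (f x) <= c * nrm x) ->
  nrm (iter n f x) <= c ^+ n * nrm x.
Proof.
move=> c0 fc; elim: n => [|n IH]; first by rewrite expr0 mul1r.
by rewrite /= exprS -mulrA (le_trans (fc _)) // ler_wpM2l.
Qed.

Variables (dot : {dot H for conjC}).
Hypothesis dot_norm : forall x : H, dot x x = `|x| ^+ 2.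
Local Notation rdot := (rdot dot).

(** With M the norm of f, |(f^2 - M^2) x|^2 <= M^2 (M^2 |x|^2 - |f x|^2), which
    comes arbitrarily close to 0 on the unit ball; so f^2 - M^2 = (f - M) (f + M)
    is not bounded below, and its two factors are not both bounded below. *)
Lemma symmetric_opnorm f c :
  (forall x y, rdot (f x) y = rdot x (f y)) ->
  (exists k, forall x, nrm (f x) <= k * nrm x) ->
  0 < opnorm f -> 0 < c ->
  (forall x, c * nrm x <= nrm (f x - (opnorm f)%:C *: x)) ->
  ~ (forall x, c * nrm x <= nrm (f x + (opnorm f)%:C *: x)).
Proof.
move=> fsym [k fk]; set M := opnorm f => M0 c0 fB fD.
have fZ a x : f (a%:C *: x) = a%:C *: f x.
  by apply: (rdot_inj dot_norm) => z; rewrite fsym !rdotZl fsym.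
have fadd x y : f (x + y) = f x + f y.
  by apply: (rdot_inj dot_norm) => z; rewrite fsym !rdotDl !fsym.
(* The second argument keeps M^2 - e nonnegative, so that its square root bounds f on the unit ball. *)
pose e := Num.min (c ^+ 4 / M ^+ 2) (M ^+ 2).
have e0 : 0 < e by rewrite lt_min divr_gt0 ?exprn_gt0.
have eM : e <= M ^+ 2 by rewrite ge_min lexx orbT.
have fe x : nrm (f x) ^+ 2 <= (M ^+ 2 - e) * nrm x ^+ 2.
  have c2 : c ^+ 2 * nrm x <= nrm (f (f x) - (M ^+ 2)%:C *: x).
    rewrite expr2 -mulrA.
    apply: le_trans (ler_wpM2l (ltW c0) (fD x)) _; apply: le_trans (fB _) _.
    rewrite fadd fZ scalerDr scalerA -rmorphM opprD addrA addrK.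
    by rewrite expr2.
  have : (c ^+ 2 * nrm x) ^+ 2 <= nrm (f (f x) - (M ^+ 2)%:C *: x) ^+ 2.
    by rewrite ler_pXn2r ?nnegrE ?mulr_ge0 ?nrm_ge0 ?exprn_ge0 // ltW.
  rewrite -[leRHS](rdotxx dot_norm) !rdotE !(rdotxx dot_norm).
  rewrite (rdotC dot x) !(fsym (f x) x) (rdotxx dot_norm) => h.
  have h2 : nrm (f (f x)) ^+ 2 <= M ^+ 2 * nrm (f x) ^+ 2.
    rewrite -exprMn ler_pXn2r ?nnegrE ?mulr_ge0 ?nrm_ge0 ?(ltW M0) //.
    exact: le_opnorm fk.
  have h3 : e * nrm x ^+ 2 <= c ^+ 4 / M ^+ 2 * nrm x ^+ 2.
    by rewrite ler_wpM2r ?sqr_ge0 // ge_min lexx.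
  suff : c ^+ 4 / M ^+ 2 * nrm x ^+ 2 <= M ^+ 2 * nrm x ^+ 2 - nrm (f x) ^+ 2 by lra.
  rewrite -(ler_pM2l (exprn_gt0 2 M0)).
  have -> : M ^+ 2 * (c ^+ 4 / M ^+ 2 * nrm x ^+ 2) = c ^+ 4 * nrm x ^+ 2.
    by field; rewrite gt_eqF.
  move: h; rewrite exprMn -exprM; lra.
have : M <= Num.sqrt (M ^+ 2 - e).
  apply: opnorm_le => x x1; rewrite -(@ler_pXn2r _ 2) ?nnegrE ?nrm_ge0 ?sqrtr_ge0 //.
  rewrite sqr_sqrtr ?subr_ge0 // (le_trans (fe x)) //.
  by rewrite ler_piMr ?subr_ge0 // expr_le1 ?nrm_ge0.
rewrite -(@ler_pXn2r _ 2) ?nnegrE ?sqrtr_ge0 ?(ltW M0) // sqr_sqrtr ?subr_ge0 //.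
by lra.
Qed.

End OperatorNorm.

(** * The operator A B^-1 and the pencil *)

Section CompInverse.
Variables (R : realType) (H : completeNormedModType R[i]).
Variables (A : linop H) (W : {linear H -> H}).

Lemma quotient_dom0 : dom A (W 0).
Proof. by rewrite linear0; exact: dom0. Qed.

Lemma quotient_domP (a : R[i]) x y :
  dom A (W x) -> dom A (W y) -> dom A (W (a *: x + y)).
Proof. by rewrite linearP; exact: domP. Qed.

Lemma quotient_opP (a : R[i]) x y : dom A (W x) -> dom A (W y) ->
  A (W (a *: x + y)) = a *: A (W x) + A (W y).
Proof. by rewrite linearP; exact: opP. Qed.

(** The operator A B^-1, when W is the inverse of B. *)
Definition quotient_op : linop H :=
  @LinOp _ _ (W @^-1` dom A) (A \o W) quotient_dom0 quotient_domP quotient_opP.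

End CompInverse.

Section Pencil.
Variables (R : realType) (H : completeNormedModType R[i]).
Variables (dot : {dot H for conjC}).
Hypothesis dot_norm : forall x : H, dot x x = `|x| ^+ 2.
Implicit Types (x y z : H) (a b c t : R).
Local Notation rdot := (rdot dot).
Variables (A B : linop H) (W : {linear H -> H}).
Hypotheses (Asa : real_self_adjoint dot A) (Adense : dense (dom A)).
Hypotheses (Bsym : symmetric_op dot B) (BW : is_inverse B W).
Hypothesis AB_comm : graph (linop_comp A B) = graph (linop_comp B A).

Local Notation T := (quotient_op A W).

Lemma inverse_sym x y : rdot (W x) y = rdot x (W y).
Proof.
have [dx Bx] := BW.2 x; have [dy By] := BW.2 y.
by rewrite -{1}By -Bsym // Bx.
Qed.

(** W A is contained in A W: evaluate A B = B A at W x. *)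
Lemma inverse_comm x : dom A x -> dom A (W x) /\ A (W x) = W (A x).
Proof.
move=> Ax; have [dx Bx] := BW.2 x.
have : graph (linop_comp A B) (W x, A x) by rewrite /graph /= Bx.
rewrite AB_comm => -[[AWx BAWx] /= ->]; split => //.
by rewrite BW.1.
Qed.

(** For v in the domain of A, T v = W A v, and <T v, z> = <v, T z> follows from
    the symmetry of A and W. A general y is approximated by
    v = i t (i t - A)^-1 y; as W commutes with A, T v = i t (i t - A)^-1 T y
    also approximates T y. *)
Lemma quotient_sym : symmetric_op dot T.
Proof.
move=> y z Ty Tz; have Asym := real_self_adjoint_sym Asa.
apply/eqP; rewrite -subr_eq0; apply/eqP.
apply: (@eq0_geometric _ (nrm z + nrm (T z))) => n.
set e := (2 ^+ n)^-1.
have e0 : 0 < e by rewrite invr_gt0 exprn_gt0.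
have [s s0 ys] := yosida dot_norm y Asym Adense e0.
have [s' _ Tys] := yosida dot_norm (T y) Asym Adense e0.
pose t := Num.max s s'.
have st : s <= t by rewrite le_max lexx.
have s't : s' <= t by rewrite le_max lexx orbT.
have t0 : t != 0 by rewrite gt_eqF // (lt_le_trans s0).
have [v Av vE] := resolvent_surj dot_norm 0 Asa t0 (- ((0 +i* t) *: y)).
have [AWv AWvE] := inverse_comm Av.
set l := 0 +i* t in vE.
have WvE : A (W v) = l *: W v - l *: W y.
  rewrite AWvE -!linearZ -linearB; congr (W _).
  by rewrite -vE [RHS]addrC subrK.
have ATv : dom A (T v).
  by rewrite /= WvE; apply: domB; exact: domZ.
have vy := ys t v st Av vE.
have Tvy : nrm (T v - T y) <= e.
  apply: (Tys t) => //; rewrite {1}/quotient_op /= {1}WvE opB; try exact: domZ.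
  by rewrite !opZ // addrAC subrr add0r.
have Tv z' : dom T z' -> rdot (T v) z' = rdot v (T z').
  by move=> Tz'; rewrite /= AWvE inverse_sym (Asym v).
have -> : rdot (T y) z - rdot y (T z) =
    rdot (v - y) (T z) - rdot (T v - T y) z.
  by rewrite !rdotDl !rdotNl Tv //; lra.
apply: le_trans (ler_normB _ _) _.
have cs := cauchy_schwarz_abs dot_norm.
apply: le_trans (lerD (cs _ _) (cs _ _)) _.
by rewrite mulrDl addrC lerD // mulrC ler_wpM2l ?nrm_ge0.
Qed.

(** On the domain of A, T is W A, whose adjoint is T because W is symmetric and A
    is self-adjoint. *)
Lemma quotient_self_adjoint : real_self_adjoint dot T.
Proof.
move=> y z; split=> [[Ty ->] x Tx|yz]; first exact: quotient_sym.
apply/Asa => x Ax; have [AWx AWxE] := inverse_comm Ax.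
by rewrite -inverse_sym -AWxE (yz x).
Qed.

(** B V inverts l - T, because the pencil is (l - T) B. *)
Lemma pencil_inverse (l : R[i]) V : is_inverse (pencil A B l) V ->
  (forall y, W (B (V y)) = V y) /\
  (forall y, dom T (B (V y)) /\ l *: B (V y) - T (B (V y)) = y) /\
  (forall x, dom T x -> B (V (l *: x - T x)) = x).
Proof.
move=> [VS SV].
have WB y : W (B (V y)) = V y by apply: BW.1; case: (SV y).1.
split => //; split=> [y|x Tx].
  by have [[AV _] /= SVy] := SV y; rewrite /= WB.
have [BWx BWxE] := BW.2 x.
have := VS (W x) (conj Tx BWx); rewrite /= BWxE => ->.
exact: BWxE.
Qed.

(** A bounded inverse V of the pencil does not directly bound (a - T)^-1 = B V;
    boundedness comes from symmetry, by [hellinger_toeplitz]. *)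
Lemma real_resolvent a : resolvent_set A B a%:C ->
  exists S : H -> H,
  [/\ forall x y, rdot (S x) y = rdot x (S y),
      forall y, dom T (S y) /\ T (S y) - a%:C *: S y = y,
      forall x, dom T x -> S (T x - a%:C *: x) = x &
      exists2 c, 0 < c & forall x, nrm (S x) <= c * nrm x].
Proof.
move=> [V [_ /pencil_inverse[_ [KP KT]]]].
pose S y := B (V (- y)).
have SP y : dom T (S y) /\ T (S y) - a%:C *: S y = y.
  by have [TS SE] := KP (- y); split => //; rewrite -opprB SE opprK.
have Ssym x y : rdot (S x) y = rdot x (S y).
  have [TSx Sx] := SP x; have [TSy Sy] := SP y.
  rewrite -{1}Sy -{2}Sx !rdotDl !rdotDr !rdotNl !rdotNr !rdotZl !rdotZr.
  by rewrite quotient_sym.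
exists S; split => //; last exact: hellinger_toeplitz Ssym.
by move=> x Tx; rewrite /S opprB KT.
Qed.

Lemma real_resolvent_below a : resolvent_set A B a%:C ->
  exists2 c, 0 < c & forall x, dom T x -> c * nrm x <= nrm (T x - a%:C *: x).
Proof.
move=> /real_resolvent[S [_ _ ST [c c0 Sc]]].
exists c^-1; first by rewrite invr_gt0.
by move=> x Tx; rewrite ler_pdivrMl // -{1}(ST x Tx).
Qed.

(** Either a is a spectral point, or one of a + 1/M and a - 1/M is, where M is the
    norm of S = (T - a)^-1: otherwise S - M and S + M would both be bounded
    below, against [symmetric_opnorm]. *)
Lemma nearest_real a : (exists x, x <> 0 :> H) ->
  exists m, spectrum A B m%:C /\
    forall x, dom T x -> `|a - m| * nrm x <= nrm (T x - a%:C *: x).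
Proof.
move=> [x0 x0N].
have [ra|sa] := pselect (resolvent_set A B a%:C); last first.
  by exists a; split => // x _; rewrite subrr normr0 mul0r nrm_ge0.
have [S [Ssym SP ST [k k0 Sk]]] := real_resolvent ra.
have SZ b x : S (b%:C *: x) = b%:C *: S x.
  by apply: (rdot_inj dot_norm) => z; rewrite Ssym !rdotZl Ssym.
have SM x : nrm (S x) <= opnorm S * nrm x by exact: le_opnorm Sk.
have M0 : 0 < opnorm S.
  rewrite lt_def opnorm_ge0 andbT; apply/eqP => M0; apply: x0N.
  have [_ <-] := SP x0.
  have -> : S x0 = 0.
    by apply: nrm_eq0; apply/eqP; rewrite eq_le nrm_ge0 andbT -(mul0r (nrm x0)) -M0.
  by rewrite op0 scaler0 subrr.
set M := opnorm S in SM M0.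
(* A spectral point at distance 1/M suffices, since |x| <= M |(T - a) x|. *)
have near_a m : `|a - m| = M^-1 -> spectrum A B m%:C ->
    exists m, spectrum A B m%:C /\
    forall x, dom T x -> `|a - m| * nrm x <= nrm (T x - a%:C *: x).
  move=> am sm; exists m; split => // x Tx; rewrite am ler_pdivrMl //.
  by rewrite -{1}(ST x Tx).
have [r1|s1] := pselect (resolvent_set A B (a + M^-1)%:C); last first.
  apply: near_a s1; rewrite opprD addrA subrr add0r normrN gtr0_norm //.
  by rewrite invr_gt0.
have [r2|s2] := pselect (resolvent_set A B (a - M^-1)%:C); last first.
  by apply: near_a s2; rewrite opprB addrC subrK gtr0_norm // invr_gt0.
exfalso.
(* With x = S y, (T - a - s) x = y - s S y: a lower bound for T - (a + s) is a
   lower bound for 1 - s S, because |y| <= |y - s S y| + |s| |S y|. *)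
have below s : `|s| = M^-1 -> resolvent_set A B (a + s)%:C ->
    exists2 c, 0 < c & forall y, c * nrm y <= nrm (y - s%:C *: S y).
  move=> sM /real_resolvent_below[c c0 cT].
  exists (c / (c + M^-1)); first by rewrite divr_gt0 // addr_gt0 // invr_gt0.
  move=> y; have [TSy SyE] := SP y.
  have := cT _ TSy.
  have -> : T (S y) - (a + s)%:C *: S y = y - s%:C *: S y.
    by rewrite rmorphD scalerDl opprD addrA SyE.
  have := nrmD (y - s%:C *: S y) (s%:C *: S y).
  rewrite subrK nrmZ modulus_real sM => h1 h2.
  rewrite mulrAC ler_pdivrMr ?addr_gt0 ?invr_gt0 //.
  rewrite -(ler_pM2l c0) in h1.
  have : M^-1 * (c * nrm (S y)) <= M^-1 * nrm (y - s%:C *: S y).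
    by rewrite ler_wpM2l // invr_ge0 ltW.
  lra.
have [c1 c10 c1P] : exists2 c, 0 < c & forall y, c * nrm y <= nrm (S y - M%:C *: y).
  have [||c c0 cP] := below M^-1; first by rewrite gtr0_norm // invr_gt0.
  - by [].
  exists (M * c) => [|y]; first by rewrite mulr_gt0.
  rewrite -mulrA (le_trans (ler_wpM2l (ltW M0) (cP y))) //.
  rewrite -[X in X * _](gtr0_norm M0) -modulus_real -nrmZ scalerBr scalerA.
  by rewrite -rmorphM mulfV ?gt_eqF // scale1r nrmB.
have [c2 c20 c2P] : exists2 c, 0 < c & forall y, c * nrm y <= nrm (S y + M%:C *: y).
  have [||c c0 cP] := below (- M^-1); first by rewrite normrN gtr0_norm // invr_gt0.
  - by [].
  exists (M * c) => [|y]; first by rewrite mulr_gt0.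
  rewrite -mulrA (le_trans (ler_wpM2l (ltW M0) (cP y))) //.
  rewrite -[X in X * _](gtr0_norm M0) -modulus_real -nrmZ scalerBr scalerA.
  by rewrite -rmorphM mulrN mulfV ?gt_eqF // rmorphN scaleN1r opprK addrC.
apply: (@symmetric_opnorm _ _ _ dot_norm S (Num.min c1 c2)) => //.
- by exists k.
- by rewrite lt_min c10.
- by move=> x; rewrite (le_trans _ (c1P x)) // ler_wpM2r ?nrm_ge0 // ge_min lexx.
- by move=> x; rewrite (le_trans _ (c2P x)) // ler_wpM2r ?nrm_ge0 // ge_min lexx orbT.
Qed.

Lemma nearest_spectrum (l : R[i]) : (exists x, x <> 0 :> H) ->
  exists m, spectrum A B m%:C /\
    forall x, dom T x -> modulus (l - m%:C) * nrm x <= nrm (l *: x - T x).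
Proof.
case: l => a b H0; have [m [sm mP]] := nearest_real a H0.
exists m; split => // x Tx.
have -> : a +i* b - m%:C = (a - m) +i* b.
  by apply/eqP; rewrite eq_complex /= subr0 !eqxx.
rewrite nrmB -(@ler_pXn2r _ 2) ?nnegrE ?mulr_ge0 ?nrm_ge0 ?modulus_ge0 //.
rewrite (sqr_nrm_shift dot_norm _ _ quotient_sym) // !exprMn sqr_modulus mulrDl lerD2r.
rewrite -(real_normK (num_real (a - m))) -exprMn.
by rewrite ler_pXn2r ?nnegrE ?mulr_ge0 ?nrm_ge0 // mP.
Qed.

(** The inverse of the pencil is W (l - T)^-1. *)
Lemma nonreal_resolvent a b : bounded_near W (nbhs (0 : H)) -> b != 0 ->
  resolvent_set A B (a +i* b).
Proof.
move=> /bounded_nrm[w w0 Ww] b0.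
have b_gt0 : 0 < `|b| by rewrite normr_gt0.
set l := a +i* b.
have below x : dom T x -> `|b| * nrm x <= nrm (l *: x - T x).
  by move=> Tx; rewrite nrmB; apply: (nrm_shift_ge_im dot_norm _ _ quotient_sym).
have /choice[K KP] : forall y, exists x, dom T x /\ l *: x - T x = y.
  move=> y; have [x Tx xE] := resolvent_surj dot_norm a quotient_self_adjoint b0 (- y).
  by exists x; rewrite -opprB xE opprK.
have inj x x' : dom T x -> dom T x' -> l *: x - T x = l *: x' - T x' -> x = x'.
  move=> Tx Tx' xx'; apply/eqP; rewrite -subr_eq0; apply/eqP/nrm_eq0/eqP.
  rewrite eq_le nrm_ge0 andbT -(pmulr_rle0 _ b_gt0).
  apply: le_trans (below _ (domB Tx Tx')) _.
  rewrite opB // scalerBr opprB (addrC (T x')) addrACA xx'.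
  by rewrite (addrC (- (l *: x'))) -(opprB (l *: x')) subrr nrm0.
have TK y : dom T (K y) by case: (KP y).
have KE y : l *: K y - T (K y) = y by case: (KP y).
have Klin : linear (W \o K).
  move=> c x y /=; rewrite -linearP; congr (W _); apply: inj => //.
    exact: domP.
  rewrite KE opP // scalerDr scalerA mulrC -scalerA opprD addrACA -scalerBr.
  by rewrite !KE.
pose V : {linear H -> H} := HB.pack (W \o K) (GRing.isLinear.Build _ _ _ _ _ Klin).
exists V; split.
  apply: (@nrm_bounded _ _ V (w / `|b|)) => y /=.
  rewrite -mulrA (le_trans (Ww _)) // ler_wpM2l // ler_pdivlMl //.
  by rewrite -{2}(KE y) below.
split=> [x [Ax Bx] /=|y].
  have WBx := BW.1 x Bx.
  rewrite -{3}WBx; congr (W _); apply: inj => //; first by rewrite /= WBx.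
  by rewrite KE /= WBx.
have [BWK BWKE] := BW.2 (K y).
split; first by split => //; exact: TK.
by rewrite /= BWKE; exact: KE.
Qed.

End Pencil.

(** * Powers of the inverse pencil *)

Section Powers.
Variables (R : realType) (H : completeNormedModType R[i]).
Implicit Types (x y : H) (f : H -> H).

Lemma root_norm_ge0 n f : 0 <= root_norm n f.
Proof. exact: powR_ge0. Qed.

Lemma root_norm_trivial n f : (forall x, x = 0 :> H) -> root_norm n f = 0.
Proof.
move=> H0; rewrite /root_norm (_ : opnorm _ = 0).
  by rewrite powR0 // invr_eq0 pnatr_eq0 expn_eq0.
apply/eqP; rewrite eq_le opnorm_ge0 andbT; apply: opnorm_le => x _.
by rewrite (H0 (iter _ _ _)) nrm0.
Qed.

(** Since W and K commute, the N-th power of V = W K is W^N K^N, and K is bounded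
    by 1/d. *)
Lemma root_norm_comp n (V K : H -> H) (W : {linear H -> H}) (d : R) :
  0 < d -> bounded_near W (nbhs (0 : H)) ->
  (forall x, W (K x) = V x) -> (forall x, K (W x) = W (K x)) ->
  (forall x, d * nrm (K x) <= nrm x) ->
  d * root_norm n V <= root_norm n W.
Proof.
move=> d0 /bounded_nrm[w w0 Ww] WK KW Kd; set N := (2 ^ n)%N.
have N0 : N%:R != 0 :> R by rewrite pnatr_eq0 expn_eq0.
have iterK m x : K (iter m W x) = iter m W (K x).
  by elim: m => //= m IH; rewrite KW IH.
have iterV m x : iter m V x = iter m W (iter m K x).
  by elim: m => //= m IH; rewrite IH -WK iterK.
have Kd' x : nrm (K x) <= d^-1 * nrm x.
  by rewrite ler_pdivlMl.
have d'0 : 0 <= d^-1 by rewrite invr_ge0 ltW.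
have WZ m (a : R) x : iter m W (a%:C *: x) = a%:C *: iter m W x.
  by elim: m => //= m ->; rewrite linearZ.
have opV : opnorm (iter N V) <= d^-1 ^+ N * opnorm (iter N W).
  apply: opnorm_le => x x1; rewrite iterV.
  apply: le_trans (le_opnorm _ (WZ N) (fun y => iter_bounded N y w0 Ww)) _.
  rewrite mulrC ler_wpM2r ?opnorm_ge0 //.
  apply: le_trans (iter_bounded N x d'0 Kd') _.
  by rewrite ler_piMr ?exprn_ge0.
rewrite -ler_pdivlMl // /root_norm -/N.
apply: le_trans (ge0_ler_powR _ _ _ opV) _;
  rewrite ?invr_ge0 ?nnegrE ?mulr_ge0 ?exprn_ge0 ?opnorm_ge0 //.
rewrite powRM ?exprn_ge0 ?opnorm_ge0 // -powR_mulrn // -powRrM mulfV //.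
by rewrite powRr1.
Qed.

End Powers.

Theorem theorem2p10 (R : realType) (H : completeNormedModType R[i])
    (dot : {dot H for conjC}) (dot_norm : forall x : H, dot x x = `|x| ^+ 2)
    (A B : linop H)
    (A_closed : closed_op A) (A_sa : self_adjoint dot A)
    (B_closed : closed_op B) (B_sa : self_adjoint dot B)
    (Binv : {linear H -> H}) (B_inv : bounded_inverse B Binv)
    (AB_comm : graph (linop_comp A B) = graph (linop_comp B A))
    (n : nat) (eps : R) (eps_gt0 : 0 < eps) :
  let r := eps * root_norm n Binv in
  pseudospectrum n eps A B `<=` minkowski_sum (spectrum A B) (disk r) /\
  minkowski_sum (spectrum A B) (disk r) `<=` minkowski_sum (real_line R) (disk r).
Proof.
move=> r.
have [W_bounded BW] := B_inv.
have A_real := self_adjoint_real A_sa.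
have B_sym := real_self_adjoint_sym (self_adjoint_real B_sa).
have A_dense := A_sa.1.
have r0 : 0 <= r by rewrite mulr_ge0 ?root_norm_ge0 // ltW.
have spectrum_real a b : spectrum A B (a +i* b) -> b = 0.
  move=> sab; apply: contrapT => /eqP b0; apply: sab.
  exact: (nonreal_resolvent dot_norm A_real A_dense B_sym BW).
split=> [l|_ [[a b] sab [t tr <-]]]; last first.
  exists a%:C; first by exists a.
  by exists t => //; rewrite (spectrum_real a b sab).
move=> [sl|[V [_ VP] epsV]].
  by exists l => //; exists 0; rewrite ?addr0 // /disk /= normr0 ler0c.
have [WK [KP KT]] := pencil_inverse BW VP.
(* On the zero space the spectrum is empty, but V has norm 0. *)
have H0 : exists x, x <> 0 :> H.
  apply: contrapT => H0; move: epsV; rewrite root_norm_trivial.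
    by rewrite leNgt invr_gt0 eps_gt0.
  by move=> x; apply: contrapT => x0; apply: H0; exists x.
have [m [sm mP]] := nearest_spectrum dot_norm A_real A_dense B_sym BW AB_comm l H0.
exists m%:C => //; exists (l - m%:C); last by rewrite addrC subrK.
rewrite /disk /= -modulusE lecR.
have [->//|d0] := eqVneq (modulus (l - m%:C)) 0.
have {d0} d_gt0 : 0 < modulus (l - m%:C) by rewrite lt_def d0 modulus_ge0.
have KW x : B (V (Binv x)) = Binv (B (V x)).
  have [TK KE] := KP x.
  have [TWK TWKE] := inverse_comm BW AB_comm TK.
  rewrite -{1}KE linearB linearZ /= -TWKE.
  exact: (KT (Binv (B (V x)))).
have Kd x : modulus (l - m%:C) * nrm (B (V x)) <= nrm x.
  by have [TK {2}<-] := KP x; apply: mP.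
have rV := root_norm_comp n d_gt0 W_bounded WK KW Kd.
have compare (d u v : R) : 0 < d -> eps^-1 <= u -> d * u <= v -> d <= eps * v.
  move=> d_ge0 epsu duv; rewrite -ler_pdivrMl // mulrC (le_trans _ duv) //.
  by rewrite ler_wpM2l // ltW.
exact: compare d_gt0 epsV rV.
Qed.
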